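(* Consider the problem of minimizing $f(x)=\sum_{v\in\mathcal V} f_v(x_v)$ subject to $Ax=b$, where each $f_v$ is convex and twice continuously differentiable with $l_v\le \nabla^2 f_v(x_v)\le u_v$ for all $x_v$ ($0<l_v\le u_v$), with unique optimizer $x^\star$. Let the weight matrix $W$ satisfy $AW=0$, $WA^\top=0$ and have $m<n$ eigenvalues at $0$, and let $\underline\lambda$ and $\overline\lambda$ be the smallest non-zero and largest eigenvalues of $WH$, $H=\nabla^2 f(x^\star)$. Let $\tilde\lambda_-$ and $\tilde\lambda_+$ be estimates of $\underline\lambda$ and $\overline\lambda$, respectively, and assume that $0<\tilde\lambda_-<\tilde\lambda_+$. Then, for all values of $\tilde\lambda_-$ and $\tilde\lambda_+$ such that $\overline\lambda<\tilde\lambda_++\tilde\lambda_-$, both the weighted gradient iteration $$x(k+1)=x(k)-\tilde\alpha W\nabla f(x(k))\quad\text{with step-size}\quad \tilde\alpha=\frac{2}{\tilde\lambda_++\tilde\lambda_-}$$ and the multi-step iteration $$x(k+1)=x(k)-\tilde\alpha W\nabla f(x(k))+\tilde\beta\,(x(k)-x(k-1))$$ with $$\tilde\alpha=\left(\frac{2}{\sqrt{\tilde\lambda_+}+\sqrt{\tilde\lambda_-}}\right)^2,\qquad \tilde\beta=\left(\frac{\sqrt{\tilde\lambda_+}-\sqrt{\tilde\lambda_-}}{\sqrt{\tilde\lambda_+}+\sqrt{\tilde\lambda_-}}\right)^2,$$ started from feasible points, converge to the optimizer $x^\star$.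
   Context: $\mathcal G=(\mathcal V,\mathcal E)$ is a graph with $\mathcal V=\{1,\dots,n\}$ and $\mathcal E\subseteq\mathcal V\times\mathcal V$. Each $f_v:\mathbf R\to\mathbf R$, $x=(x_v)_{v\in\mathcal V}\in\mathbf R^n$, $A\in\mathbf R^{m\times n}$, and $b\in\mathbf R^m$ lies in the range of $A$. The weight matrix $W\in\mathbf R^{n\times n}$ satisfies $W_{vw}=0$ if $v\ne w$ and $(v,w)\notin\mathcal E$. A point $x$ is feasible if $Ax=b$; the weighted gradient iteration starts from a feasible $x(0)$ and the multi-step iteration from feasible $x(0),x(1)$.
   Formalization: Convergence is proved only from feasible points within some distance δ>0 of x* (from arbitrary feasible points it fails for non-quadratic f); also assumed: A has full row rank m, all eigenvalues of WH are real, and the smallest non-zero one is positive. *)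

(* Defs.v *)
From mathcomp Require Import all_boot all_order all_algebra.
From mathcomp Require Import all_classical all_reals all_analysis.
From mathcomp Require Import complex.

Set Implicit Arguments.
Unset Strict Implicit.
Unset Printing Implicit Defensive.

Import Order.TTheory GRing.Theory Num.Theory.
Import numFieldNormedType.Exports.

Local Open Scope ring_scope.
Local Open Scope classical_set_scope.

Definition twice_continuously_differentiable (R : realType) (g : R -> R) :
    Prop :=
  [/\ forall t, derivable g t 1,
      forall t, derivable (g^`()) t 1
    & continuous (g^`())^`()].

Definition separable (R : realType) (n : nat) (f : 'I_n -> R -> R)
    (x : 'cV[R]_n) : R :=
  \sum_(v < n) f v (x v 0).

Definition gradient (R : realType) (n : nat) (F : 'cV[R]_n -> R)
    (x : 'cV[R]_n) : 'cV[R]_n :=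
  \col_i 'D_(delta_mx i 0) F x.

Definition hessian (R : realType) (n : nat) (F : 'cV[R]_n -> R)
    (x : 'cV[R]_n) : 'M[R]_n :=
  \matrix_(i, j) 'D_(delta_mx j 0) (fun y => gradient F y i 0) x.

Definition feasible (R : realType) (m n : nat) (A : 'M[R]_(m, n))
    (b : 'cV[R]_m) (x : 'cV[R]_n) : Prop :=
  A *m x = b.

Definition optimizer (R : realType) (m n : nat) (A : 'M[R]_(m, n))
    (b : 'cV[R]_m) (F : 'cV[R]_n -> R) (x : 'cV[R]_n) : Prop :=
  feasible A b x /\ forall y, feasible A b y -> F x <= F y.

Definition unique_optimizer (R : realType) (m n : nat) (A : 'M[R]_(m, n))
    (b : 'cV[R]_m) (F : 'cV[R]_n -> R) (x : 'cV[R]_n) : Prop :=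
  optimizer A b F x /\ forall y, optimizer A b F y -> y = x.

Definition supported_on_graph (R : realType) (n : nat)
    (E : {set 'I_n * 'I_n}) (W : 'M[R]_n) : Prop :=
  forall v w, v != w -> (v, w) \notin E -> W v w = 0.

(* W H need not be symmetric, so its spectrum is taken over the complex
   numbers. *)
Definition real_spectrum (R : realType) (n : nat) (M : 'M[R]_n) : Prop :=
  forall z : R[i],
    eigenvalue (map_mx (real_complex R) M) z -> complex.Im z = 0.

Definition smallest_nonzero_eigenvalue (R : realType) (n : nat) (M : 'M[R]_n)
    (lam : R) : Prop :=
  [/\ eigenvalue M lam, lam != 0
    & forall mu, eigenvalue M mu -> mu != 0 -> lam <= mu].

Definition largest_eigenvalue (R : realType) (n : nat) (M : 'M[R]_n)
    (lam : R) : Prop :=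
  eigenvalue M lam /\ forall mu, eigenvalue M mu -> mu <= lam.

Definition weighted_gradient_iteration (R : realType) (n : nat)
    (F : 'cV[R]_n -> R) (W : 'M[R]_n) (alpha : R) (x : nat -> 'cV[R]_n) :
    Prop :=
  forall k, x k.+1 = x k - alpha *: (W *m gradient F (x k)).

Definition multi_step_iteration (R : realType) (n : nat)
    (F : 'cV[R]_n -> R) (W : 'M[R]_n) (alpha beta : R)
    (x : nat -> 'cV[R]_n) : Prop :=
  forall k, x k.+2 = x k.+1 - alpha *: (W *m gradient F (x k.+1))
                     + beta *: (x k.+1 - x k).

(* Main.v *)
(** Feasible iterates stay in [xstar + ker A], and optimality puts the gradient at
    [xstar] in the range of [A^T], which [W] kills.  So the error follows, up to
    a remainder [o(e)], the linear recurrence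
    [e_(k+2) = (1 + beta - alpha W H) e_(k+1) - beta e_k] on [ker A].  Since [0]
    has algebraic multiplicity [m] for [W], the kernel of [W] is exactly the range
    of [A^T], and positivity of [H] makes [W H] injective on [ker A].  Only the
    eigenvalues of [W H] in [[lmin, lmax]] matter there, and for them
    [0 < alpha lambda < 2 (1 + beta)] is Jury's stability condition.  Applying
    Cayley-Hamilton over [R[i]] reduces the decay of the linear recurrence to
    scalar ones, and a Lyapunov function absorbs the remainder. *)
Require Import Defs.
From mathcomp Require Import all_boot all_order all_algebra.
From mathcomp Require Import all_classical all_reals all_analysis.
From mathcomp Require Import complex ring lra.

Set Implicit Arguments.
Unset Strict Implicit.
Unset Printing Implicit Defensive.

Import Order.TTheory GRing.Theory Num.Theory.
Import numFieldNormedType.Exports.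

Local Open Scope ring_scope.
Local Open Scope classical_set_scope.

(** * Geometric decay of scalar sequences and linear recurrences *)

(** The constants live in [K] itself; their sign conditions force them to be real, so one notion
    serves both [R] and [R[i]]. *)
Definition decays (K : numFieldType) (y : nat -> K) : Prop :=
  exists C rho : K,
    [/\ 0 <= C, 0 < rho, rho < 1 & forall k, `|y k| <= C * rho ^+ k].

(* The rate [p + q - p * q] dominates both [p] and [q] and avoids maxima, which
   are not available in a partially ordered field. *)
Lemma common_rate (K : numFieldType) (p q : K) :
  0 <= p -> p < 1 -> 0 < q -> q < 1 ->
  [/\ p < p + q - p * q, q <= p + q - p * q & p + q - p * q < 1].
Proof.
move=> p0 p1 q0 q1.
have -> : p + q - p * q = p + q * (1 - p) by ring.
split.
- by rewrite ltrDl mulr_gt0 // subr_gt0.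
- have -> : p + q * (1 - p) = q + p * (1 - q) by ring.
  by rewrite lerDl mulr_ge0 // subr_ge0 ltW.
- have -> : p + q * (1 - p) = 1 - (1 - p) * (1 - q) by ring.
  by rewrite gtrBl mulr_gt0 // subr_gt0.
Qed.

Lemma decays0 (K : numFieldType) : decays (fun=> 0 : K).
Proof.
exists 0, 2^-1; split=> [//|||k].
- by rewrite invr_gt0 ltr0n.
- by rewrite invf_lt1 ?ltr0n // ltr1n.
- by rewrite normr0 mul0r.
Qed.

Lemma decays_ext (K : numFieldType) (y z : nat -> K) :
  y =1 z -> decays y -> decays z.
Proof. by move=> yz [C [r [? ? ? yC]]]; exists C, r; split=> // k; rewrite -yz. Qed.

Lemma decaysD (K : numFieldType) (y z : nat -> K) :
  decays y -> decays z -> decays (fun k => y k + z k).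
Proof.
move=> [C [p [C0 p0 p1 yC]]] [D [q [D0 q0 q1 zD]]].
have [pr qr r1] := common_rate (ltW p0) p1 q0 q1.
exists (C + D), (p + q - p * q); split=> [|||k]; first exact: addr_ge0.
- exact: lt_trans p0 pr.
- exact: r1.
- apply: le_trans (ler_normD _ _) _; rewrite mulrDl lerD //.
  + apply: le_trans (yC k) _; apply: ler_wpM2l => //.
    by apply: lerXn2r; rewrite ?nnegrE ltW // (lt_trans p0 pr).
  + apply: le_trans (zD k) _; apply: ler_wpM2l => //.
    by apply: lerXn2r; rewrite ?nnegrE // ltW // (lt_trans p0 pr).
Qed.

Lemma decaysZ (K : numFieldType) (c : K) (y : nat -> K) :
  decays y -> decays (fun k => c * y k).
Proof.
move=> [C [r [C0 r0 r1 yC]]]; exists (`|c| * C), r; split=> [|//|//|k].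
- by rewrite mulr_ge0.
- by rewrite normrM -mulrA ler_wpM2l.
Qed.

Lemma decays_sum (K : numFieldType) (I : Type) (s : seq I)
    (y : I -> nat -> K) :
  (forall i, decays (y i)) -> decays (fun k => \sum_(i <- s) y i k).
Proof.
move=> yd; elim: s => [|i s IHs].
  by apply: decays_ext (decays0 K) => k; rewrite big_nil.
by apply: decays_ext (decaysD (yd i) IHs) => k; rewrite big_cons.
Qed.

Lemma decaysS (K : numFieldType) (y : nat -> K) :
  decays y -> decays (fun k => y k.+1).
Proof.
move=> [C [r [C0 r0 r1 yC]]]; exists (C * r), r; split=> [|//|//|k].
- by rewrite mulr_ge0 // ltW.
- by rewrite -mulrA -exprS.
Qed.

(** A rate [r] strictly above [|mu|] and at least that of the forcing leaves room to absorb the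
    forcing: the constant [C / (r - |mu|)] reproduces itself in the induction, as
    [|mu| * c + C = c * r]. *)
Lemma decays_rec1 (K : numFieldType) (mu : K) (y : nat -> K) :
  `|mu| < 1 -> decays (fun k => y k.+1 - mu * y k) -> decays y.
Proof.
move=> mu1 [C [q [C0 q0 q1 yC]]].
have [mur qr r1] := common_rate (normr_ge0 mu) mu1 q0 q1.
set r := `|mu| + q - `|mu| * q in mur qr r1.
have r0 : 0 < r by apply: lt_le_trans q0 qr.
have D0 : 0 <= C / (r - `|mu|) by rewrite divr_ge0 // subr_ge0 ltW.
exists (`|y 0%N| + C / (r - `|mu|)), r; split=> //; first exact: addr_ge0.
elim=> [|k IHk]; first by rewrite expr0 mulr1 lerDl.
have -> : y k.+1 = mu * y k + (y k.+1 - mu * y k) by ring.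
apply: le_trans (ler_normD _ _) _; rewrite normrM.
apply: (@le_trans _ _
  (`|mu| * ((`|y 0%N| + C / (r - `|mu|)) * r ^+ k) + C * r ^+ k)).
  apply: lerD; first exact: ler_wpM2l.
  apply: le_trans (yC k) _; apply: ler_wpM2l => //.
  by apply: lerXn2r; rewrite ?nnegrE // ltW.
have CE : C = C / (r - `|mu|) * (r - `|mu|).
  by rewrite divfK // subr_eq0 gt_eqF.
set c := C / _ in CE *.
rewrite [in C * _]CE exprS -subr_ge0.
have -> : (`|y 0%N| + c) * (r * r ^+ k) -
  (`|mu| * ((`|y 0%N| + c) * r ^+ k) + c * (r - `|mu|) * r ^+ k) =
  `|y 0%N| * (r - `|mu|) * r ^+ k by ring.
apply: mulr_ge0; last by rewrite exprn_ge0 // ltW.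
by apply: mulr_ge0 => //; rewrite subr_ge0 ltW.
Qed.

Lemma norm_lt1_of_mul_conj_lt1 (C : numClosedFieldType) (z : C) :
  z * z^* < 1 -> `|z| < 1.
Proof. by rewrite -normCK => h; rewrite -(@expr_lt1 _ 2). Qed.

(* Jury's criterion: both roots of [X^2 - a X + b] lie in the open unit disk. *)
Lemma decays_rec2 (C : numClosedFieldType) (a b : C) (y : nat -> C) :
  a \is Num.real -> 0 <= b -> b < 1 -> `|a| < 1 + b ->
  decays (fun k => y k.+2 - a * y k.+1 + b * y k) -> decays y.
Proof.
move=> aR b0 b1 ab yd.
set d := sqrtC (a ^+ 2 - 4 * b).
have dK : d ^+ 2 = a ^+ 2 - 4 * b by rewrite sqrtCK.
pose r1 := (a + d) / 2; pose r2 := (a - d) / 2.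
have two0 : (2 : C) != 0 by rewrite pnatr_eq0.
have rD : r1 + r2 = a by rewrite /r1 /r2; field.
have rM : r1 * r2 = b.
  have -> : r1 * r2 = (a ^+ 2 - d ^+ 2) / 4 by rewrite /r1 /r2; field.
  by rewrite dK; field.
have bR : b \is Num.real by rewrite ger0_real.
have discR : a ^+ 2 - 4 * b \is Num.real by rewrite realB ?realM ?realn // realX.
have [l1 l2] : `|r1| < 1 /\ `|r2| < 1.
  (* The roots are either both real or complex conjugates. *)
  have [disc0|disc0] := real_leP (real0 C) discR.
    have d0 : 0 <= d by rewrite sqrtC_ge0.
    have dR := ger0_real d0.
    have /andP [am ap] : (- (1 + b) < a < 1 + b).
      by rewrite -real_ltr_norml.
    (* Applied to [e = a] and [e = - a], this bounds [|a| + d] by [2]. Squaring reduces it to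
       [4 * (1 + b - e) > 0]. *)
    have dlt e : `|e| = `|a| -> e \is Num.real -> d < 2 - e.
      move=> ea eR.
      have e2 : e < 2.
        apply: le_lt_trans (real_ler_norm eR) _; rewrite ea.
        by apply: lt_trans ab _; rewrite -[2]/(1 + 1) ltrD2l.
      rewrite -(@ltr_pXn2r _ 2) ?nnegrE ?subr_ge0 ?(ltW e2) // dK.
      rewrite -[a ^+ 2]real_normK // -ea real_normK // -subr_gt0.
      have -> : (2 - e) ^+ 2 - (e ^+ 2 - 4 * b) = 4 * (1 + b - e) by ring.
      rewrite mulr_gt0 ?ltr0n // subr_gt0.
      by apply: le_lt_trans (real_ler_norm eR) _; rewrite ea.
    have h1 := dlt a erefl aR.
    have h2 : d < 2 + a by have := dlt (- a) (normrN a); rewrite realN opprK; apply.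
    have r1R : r1 \is Num.real by rewrite realM ?realV ?realn ?realD.
    have r2R : r2 \is Num.real by rewrite realM ?realV ?realn ?realB.
    rewrite !real_ltr_norml //.
    have p2 : 0 < (2 : C) by rewrite ltr0n.
    have t1 : - 2 - d <= - 2 :> C by rewrite gerBl.
    have t2 : 2 <= 2 + d :> C by rewrite lerDl.
    have ma : - 2 < a by rewrite -subr_gt0 opprK; apply: le_lt_trans d0 _; rewrite addrC.
    have pa : a < 2 by rewrite -subr_gt0; apply: le_lt_trans d0 _.
    rewrite /r1 /r2 !ltr_pdivrMr // !ltr_pdivlMr // !mulN1r !mul1r.
    split; apply/andP; split.
    + by apply: lt_le_trans ma _; rewrite lerDl.
    + by rewrite -ltrBrDl.
    + by rewrite ltrBrDl -ltrBrDr opprK addrC.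
    + by apply: le_lt_trans _ pa; rewrite gerBl.
  (* For a negative discriminant [d] is purely imaginary, so the roots are conjugate and their
     squared modulus is their product [b < 1]. *)
  have dC : d^* = - d.
    pose t := sqrtC (4 * b - a ^+ 2).
    have tR : t \is Num.real.
      by rewrite ger0_real // sqrtC_ge0 subr_ge0 -subr_le0 ltW.
    have /eqP : d ^+ 2 = ('i * t) ^+ 2.
      by rewrite dK exprMn sqrCi sqrtCK; ring.
    by rewrite eqf_sqr => /orP[]/eqP ->;
      rewrite ?rmorphN rmorphM /= conjCi (CrealP tR) mulNr.
  have r1C : r1^* = r2.
    by rewrite /r1 rmorphM /= rmorphD /= fmorphV rmorph_nat /= dC (CrealP aR).
  have r2C : r2^* = r1 by rewrite -r1C conjCK.
  by split; apply: norm_lt1_of_mul_conj_lt1; rewrite ?r1C ?r2C 1?[r2 * _]mulrC rM.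
(* The second-order operator factors into two first-order ones, one per root. *)
apply: (decays_rec1 l1); apply: (decays_rec1 l2).
apply: decays_ext yd => k; rewrite -rD -rM; ring.
Qed.

(** * Multiplicity of the eigenvalue [0] and the kernel of [W] *)

Lemma prod_if_lt (K : comPzRingType) (n r : nat) (x : K) : (r <= n)%N ->
  \prod_(i < n) (if (i < r)%N then 1 else x) = x ^+ (n - r).
Proof.
move=> rn; rewrite -(big_mkord xpredT (fun i => if (i < r)%N then 1 else x)).
rewrite (big_cat_nat (n := r)) //= big_nat big1 => [|i /andP[_ ->] //].
rewrite mul1r big_nat (eq_bigr (fun=> x)) => [|i /andP[ri _]].
  by rewrite -big_nat prodr_const_nat.
by rewrite ltnNge ri.
Qed.

(* With [W = L *m pid_mx r *m U], [W] is similar to [pid_mx r *m (U *m L)], whose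
   last [n - r] rows vanish; each such row of the characteristic matrix
   contributes a factor ['X]. *)
Lemma geometric_le_algebraic_multiplicity (F : fieldType) (n : nat)
    (W : 'M[F]_n) : (n - \rank W <= mup 0 (char_poly W))%N.
Proof.
have cp0 : char_poly W != 0 by rewrite monic_neq0 ?char_poly_monic.
rewrite mup_geq // subr0.
set L := col_ebase W; set U := row_ebase W; set r := \rank W.
pose G := U *m L.
pose D : 'M[{poly F}]_n :=
  diag_mx (\row_i (if (i < r)%N then 1 else 'X)).
pose N : 'M[{poly F}]_n := \matrix_(i, j)
  if (i < r)%N then char_poly_mx (pid_mx r *m G) i j else (i == j)%:R.
have rows : char_poly_mx (pid_mx r *m G) = D *m N.
  apply/matrixP => i j; rewrite mul_diag_mx !mxE.
  case: ifP => ir; first by rewrite mul1r.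
  rewrite big1 ?subr0 => [|k _]; first by rewrite mulr_natr.
  by rewrite !mxE ir andbF mul0r.
have conj : char_poly_mx W *m map_mx polyC L =
            map_mx polyC L *m char_poly_mx (pid_mx r *m G).
  rewrite /char_poly_mx mulmxBl mulmxBr scalar_mxC; congr (_ - _).
  by rewrite -!map_mxM /G !mulmxA (mulmx_ebase W).
have L0 : \det (map_mx polyC L) != 0 :> {poly F}.
  rewrite det_map_mx polyC_eq0 -unitfE -unitmxE; exact: col_ebase_unit.
have detE : char_poly W = 'X ^+ (n - r) * \det N.
  apply: (mulIf L0); rewrite /char_poly -det_mulmx conj det_mulmx mulrC.
  congr (_ * _); rewrite rows det_mulmx det_diag; congr (_ * _).
  rewrite -(prod_if_lt 'X (rank_leq_row W)).
  by apply: eq_bigr => i _; rewrite mxE.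
by rewrite detE dvdp_mulr.
Qed.

Lemma col_eq0 (F : nmodType) (m n : nat) (M : 'M[F]_(m, n)) :
  (forall j, col j M = 0) -> M = 0.
Proof.
by move=> M0; apply/matrixP => i j; have /colP/(_ i) := M0 j; rewrite !mxE.
Qed.

(** The columns of [cokermx A] lie in [ker A], hence are killed by [g^T], which is the criterion for
    [g^T] to be in the row space of [A]. This yields the Lagrange multipliers. *)
Lemma row_space_of_orthogonal (F : fieldType) (m n : nat) (A : 'M[F]_(m, n))
    (g : 'cV[F]_n) :
  (forall s : 'cV_n, A *m s = 0 -> g^T *m s = 0) ->
  exists nu : 'cV_m, g = A^T *m nu.
Proof.
move=> orth; suff /submxP[D gE] : (g^T <= A)%MS.
  by exists D^T; rewrite -trmx_mul -gE trmxK.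
rewrite submxE; apply/eqP/col_eq0 => j.
rewrite colE -mulmxA; apply: orth.
by rewrite mulmxA mulmx_coker mul0mx.
Qed.

(** A dimension count: the range of [A^T] lies in [ker W], and [dim ker W = n - rank W] is at most
    the algebraic multiplicity of [0], hence at most [m = rank A]. *)
Lemma kernel_eq_range_trmx (F : fieldType) (m n : nat) (A : 'M[F]_(m, n))
    (W : 'M[F]_n) (v : 'cV[F]_n) :
  \rank A = m -> W *m A^T = 0 -> (mup 0 (char_poly W) <= m)%N ->
  W *m v = 0 -> exists nu : 'cV_m, v = A^T *m nu.
Proof.
move=> rA WA mupW Wv.
have AK : (A <= kermx W^T)%MS.
  by apply/sub_kermxP; rewrite -[A]trmxK -trmx_mul WA trmx0.
have KA : (kermx W^T <= A)%MS.
  rewrite -(mxrank_leqif_sup AK) eqn_leq mxrankS //= rA mxrank_ker mxrank_tr.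
  exact: leq_trans (geometric_le_algebraic_multiplicity W) mupW.
have /submxP[D vE] : (v^T <= A)%MS.
  apply: submx_trans _ KA; apply/sub_kermxP.
  by rewrite -trmx_mul Wv trmx0.
by exists D^T; rewrite -trmx_mul -vE trmxK.
Qed.

(** With [H = diag_mx h], the vector [H s] is some [A^T nu], so [s^T H s = (A s)^T nu = 0], and [H]
    is positive definite. *)
Lemma weighted_hessian_injective (F : realFieldType) (m n : nat)
    (A : 'M[F]_(m, n)) (W : 'M[F]_n) (h : 'rV[F]_n) (s : 'cV[F]_n) :
  \rank A = m -> W *m A^T = 0 -> (mup 0 (char_poly W) <= m)%N ->
  (forall i, 0 < h 0 i) ->
  A *m s = 0 -> W *m diag_mx h *m s = 0 -> s = 0.
Proof.
move=> rA WA mupW h0 As; rewrite -mulmxA => WHs.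
have [nu hs] := kernel_eq_range_trmx rA WA mupW WHs.
have sHs : (s^T *m (diag_mx h *m s)) 0 0 = 0.
  by rewrite hs mulmxA -trmx_mul As trmx0 mul0mx mxE.
have term i : s i 0 * (h 0 i * s i 0) = h 0 i * s i 0 ^+ 2.
  by rewrite expr2; ring.
have sum0 : \sum_i h 0 i * s i 0 ^+ 2 = 0.
  rewrite -[RHS]sHs mxE; apply: eq_bigr => i _.
  by rewrite mul_diag_mx !mxE term.
have nneg i : true -> 0 <= h 0 i * s i 0 ^+ 2.
  by rewrite mulr_ge0 ?sqr_ge0 // ltW.
apply/colP => i; rewrite mxE.
have /eqP := @psumr_eq0P _ _ _ _ nneg sum0 i erefl.
by rewrite mulf_eq0 gt_eqF //= sqrf_eq0 => /eqP.
Qed.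

(** * Projection onto [ker A] and inversion on a range *)

(** [kermx] acts on row vectors; the two transpositions turn this into a projector of column vectors
    onto [ker A], not necessarily an orthogonal one. *)
Definition kernel_projector (F : fieldType) (m n : nat) (A : 'M[F]_(m, n)) :
    'M[F]_n := (pinvmx (kermx A^T) *m kermx A^T)^T.

Lemma kernel_projector_ker (F : fieldType) (m n : nat) (A : 'M[F]_(m, n)) :
  A *m kernel_projector A = 0.
Proof.
by rewrite -[A in A *m _]trmxK -trmx_mul -mulmxA mulmx_ker mulmx0 trmx0.
Qed.

Lemma kernel_projector_id (F : fieldType) (m n p : nat) (A : 'M[F]_(m, n))
    (Y : 'M[F]_(n, p)) :
  A *m Y = 0 -> kernel_projector A *m Y = Y.
Proof.
move=> AY; rewrite -[Y in LHS]trmxK -trmx_mul mulmxA mulmxKpV ?trmxK //.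
by apply/sub_kermxP; rewrite -trmx_mul AY trmx0.
Qed.

(** Each column of [cokermx (B *m P)] is killed by [B *m P], hence by [P], so the row space of [P]
    lies in that of [B *m P]. *)
Lemma left_inverse_on_range (F : fieldType) (n p : nat) (B : 'M[F]_n)
    (P : 'M[F]_(n, p)) :
  (forall v : 'cV_p, B *m (P *m v) = 0 -> P *m v = 0) ->
  exists L : 'M[F]_n, L *m (B *m P) = P.
Proof.
move=> inj; suff /submxP[L PE] : (P <= B *m P)%MS by exists L.
rewrite submxE; apply/eqP/col_eq0 => j.
rewrite colE -mulmxA inj //.
by rewrite 2!mulmxA mulmx_coker mul0mx.
Qed.

(** * Decay of matrix recurrences *)

Definition mx_decays (K : numFieldType) (n p : nat) (Y : nat -> 'M[K]_(n, p)) :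
    Prop :=
  forall i j, decays (fun k => Y k i j).

Lemma mx_decays_mull (K : numFieldType) (m n p : nat) (L : 'M[K]_(m, n))
    (Y : nat -> 'M[K]_(n, p)) :
  mx_decays Y -> mx_decays (fun k => L *m Y k).
Proof.
move=> Yd i j.
apply: (@decays_ext _ (fun k => \sum_l L i l * Y k l j)) => [k|].
  by rewrite mxE.
by apply: decays_sum => l; apply: decaysZ.
Qed.

(* Induction on the roots: [(B - z) Y_k] decays by induction and forces the
   recurrence satisfied by the entries of [Y_k], which for [z <> 0] is a stable
   scalar one; the root [z = 0] is removed by inverting [B] on the range of [P]. *)
Lemma mx_decays_of_annihilator (C : numClosedFieldType) (n p : nat)
    (B L P : 'M[C]_n.+1) (al be : C) (s : seq C) (Y : nat -> 'M[C]_(n.+1, p)) :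
  0 < al -> 0 <= be -> be < 1 ->
  {in s, forall z, z = 0 \/ (0 < z /\ al * z < 2 * (1 + be))} ->
  P *m B = B -> L *m (B *m P) = P ->
  (forall k, P *m Y k = Y k) ->
  (forall k, Y k.+2 =
     (1 + be) *: Y k.+1 - al *: (B *m Y k.+1) - be *: Y k) ->
  (forall k, horner_mx B (\prod_(z <- s) ('X - z%:P)) *m Y k = 0) ->
  mx_decays Y.
Proof.
move=> al0 be0 be1 sP PB LBP; elim: s sP Y => [|z s IHs] sP Y PY rec ann.
  move=> i j; apply: decays_ext (decays0 C) => k.
  by have := ann k; rewrite big_nil rmorph1 mul1mx => ->; rewrite mxE.
pose M := B - z%:M.
have MB : M *m B = B *m M by rewrite mulmxBl mulmxBr scalar_mxC.
have MYd : mx_decays (fun k => M *m Y k).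
  apply: IHs => [w ws|k|k|k].
  - by apply: sP; rewrite inE ws orbT.
  - by rewrite mulmxA mulmxBr PB mul_mx_scalar !mulmxBl mul_scalar_mx
      -scalemxAl PY.
  - by rewrite rec !mulmxBr -!scalemxAr [M *m (B *m _)]mulmxA MB mulmxA.
  - have := ann k; rewrite big_cons mulrC rmorphM rmorphB /= horner_mx_X.
    by rewrite horner_mx_C -mulmxA.
have [z0|[z0 alz]] := sP z (mem_head z s).
  have YE k : L *m (M *m Y k) = Y k.
    by rewrite /M z0 raddf0 subr0 -[in LHS]PY !mulmxA -(mulmxA L) LBP PY.
  by move=> i j; apply: decays_ext (mx_decays_mull L MYd i j) => k; rewrite YE.
move=> i j.
have be1p : 0 < 1 + be by rewrite ltr_wpDr.
have aR : 1 + be - al * z \is Num.real.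
  by rewrite realB ?ger0_real // ?ltW // mulr_gt0.
apply: (decays_rec2 aR be0 be1).
  (* The two inequalities are exactly [al * z < 2 * (1 + be)] and [0 < al * z]. *)
  rewrite real_ltr_norml //; apply/andP; split.
    rewrite -subr_gt0 (_ : _ - _ = 2 * (1 + be) - al * z); last by ring.
    by rewrite subr_gt0.
  by rewrite gtrBl mulr_gt0.
(* Replacing [B] by [z] in the recurrence leaves the forcing [- al * (B - z) Y_(k+1)]. *)
apply: decays_ext (decaysZ (- al) (decaysS (MYd i j))) => k /=.
rewrite rec /M mulmxBl mul_scalar_mx !mxE; ring.
Qed.

Lemma decays_real_complex (R : rcfType) (y : nat -> R) :
  decays (fun k => real_complex R (y k)) -> decays y.
Proof.
move=> [c [r [c0 r0 r1 yC]]].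
have cE : c = (complex.Re c)%:C%C by rewrite RRe_real // ger0_real.
have rE : r = (complex.Re r)%:C%C by rewrite RRe_real // gtr0_real.
exists (complex.Re c), (complex.Re r); split=> [|||k].
- by rewrite -lecR -cE.
- by rewrite -ltcR -rE.
- by rewrite -ltcR -rE.
- have := yC k; rewrite cE rE -rmorphXn -rmorphM /= normc_def /= expr0n addr0.
  by rewrite sqrtr_sqr lecR.
Qed.

(** Over [R[i]] the characteristic polynomial splits and, by Cayley-Hamilton, annihilates [B]. Its
    roots are real, so each is the image of an eigenvalue over [R] and inherits the bounds assumed
    there. *)
Lemma mx_decays_of_real_spectrum (R : rcfType) (n p : nat)
    (B L P : 'M[R]_n.+1) (al be : R) (Y : nat -> 'M[R]_(n.+1, p)) :
  0 < al -> 0 <= be -> be < 1 ->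
  (forall z : R[i], eigenvalue (map_mx (real_complex R) B) z ->
     complex.Im z = 0) ->
  (forall la, eigenvalue B la -> la != 0 -> 0 < la /\ al * la < 2 * (1 + be)) ->
  P *m B = B -> L *m (B *m P) = P ->
  (forall k, P *m Y k = Y k) ->
  (forall k, Y k.+2 =
     (1 + be) *: Y k.+1 - al *: (B *m Y k.+1) - be *: Y k) ->
  mx_decays Y.
Proof.
move=> al0 be0 be1 Breal Beig PB LBP PY rec i j.
pose toC := real_complex R; pose Bc := map_mx toC B.
have [s sE] := closed_field_poly_normal (char_poly Bc).
move: sE; rewrite (monicP (char_poly_monic Bc)) scale1r => sE.
apply: decays_real_complex.
apply: (@decays_ext _ (fun k => map_mx toC (Y k) i j)) => [k|].
  by rewrite mxE.
move: i j; apply: (@mx_decays_of_annihilator _ _ _ Bc (map_mx toC L)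
  (map_mx toC P) (toC al) (toC be) s).
- by rewrite ltcR.
- by rewrite lecR.
- by rewrite ltcR.
- move=> z zs.
  have eigz : eigenvalue Bc z by rewrite eigenvalue_root_char sE root_prod_XsubC.
  have zE : z = toC (complex.Re z).
    by case: z {zs} eigz => x y /Breal /= ->.
  have [z0|z0] := eqVneq (complex.Re z) 0.
    by left; rewrite zE z0.
  right; have [|la0 alla] := Beig (complex.Re z) _ z0.
    by move: eigz; rewrite zE !eigenvalue_root_char -map_char_poly fmorph_root.
  rewrite zE -rmorphM -(rmorph1 toC) -rmorphD -(rmorph_nat toC 2) -rmorphM.
  by rewrite !ltcR.
- by rewrite -map_mxM PB.
- by rewrite -!map_mxM LBP.
- by move=> k; rewrite -map_mxM PY.
- move=> k; rewrite rec -(rmorph1 toC) -rmorphD -map_mxM -!map_mxZ.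
  by rewrite -!map_mxB.
- by move=> k; rewrite -sE Cayley_Hamilton mul0mx.
Qed.

(** * Estimates for the entrywise maximum norm *)

Lemma mx_entry_le_norm (R : realType) (m n : nat) (M : 'M[R]_(m, n)) i j :
  `|M i j| <= `|M|.
Proof.
have -> : `|M| = mx_norm M by [].
by rewrite mx_normrE (le_bigmax _ (fun ij => `|M ij.1 ij.2|) (i, j)).
Qed.

Lemma mx_norm_le (R : realType) (m n : nat) (M : 'M[R]_(m, n)) (c : R) :
  0 <= c -> (forall i j, `|M i j| <= c) -> `|M| <= c.
Proof.
move=> c0 Mc; have -> : `|M| = mx_norm M by [].
by rewrite mx_normrE; apply: bigmax_le.
Qed.

(** The maximum norm is not submultiplicative; the factor [n] counts the terms of each entry of the
    product. *)
Lemma mx_norm_mul (R : realType) (m n p : nat) (M : 'M[R]_(m, n))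
    (N : 'M[R]_(n, p)) :
  `|M *m N| <= n%:R * `|M| * `|N|.
Proof.
apply: mx_norm_le => [|i j]; first by rewrite !mulr_ge0.
rewrite mxE; apply: le_trans (ler_norm_sum _ _ _) _.
apply: (@le_trans _ _ (\sum_(k < n) `|M| * `|N|)); last first.
  by rewrite sumr_const card_ord -mulrA mulr_natl.
by apply: ler_sum => k _; rewrite normrM ler_pM ?mx_entry_le_norm.
Qed.

Lemma mx_norm_col_mx_le (R : realType) (m n p : nat) (M : 'M[R]_(m, p))
    (N : 'M[R]_(n, p)) (c : R) :
  0 <= c -> `|M| <= c -> `|N| <= c -> `|col_mx M N| <= c.
Proof.
move=> c0 Mc Nc; apply: mx_norm_le => // i j.
rewrite mxE; case: splitP => k _;
  by apply: le_trans (mx_entry_le_norm _ _ _) _.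
Qed.

Lemma mx_norm_usubmx_le (R : realType) (m n p : nat) (M : 'M[R]_(m, p))
    (N : 'M[R]_(n, p)) :
  `|M| <= `|col_mx M N|.
Proof.
apply: mx_norm_le => // i j.
by rewrite -(col_mxEu M N) mx_entry_le_norm.
Qed.

Lemma mx_norm_dsubmx_le (R : realType) (m n p : nat) (M : 'M[R]_(m, p))
    (N : 'M[R]_(n, p)) :
  `|N| <= `|col_mx M N|.
Proof.
apply: mx_norm_le => // i j.
by rewrite -(col_mxEd M N) mx_entry_le_norm.
Qed.

(** * From linear decay to stability under small perturbations *)

Lemma decays_lt (R : realType) (y : nat -> R) (e : R) :
  decays y -> 0 < e -> \forall k \near \oo, `|y k| <= e.
Proof.
move=> [c [r [c0 r0 r1 yc]]] e0.
have : c * r ^+ k @[k --> \oo] --> (0 : R).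
  rewrite -[0 : R](mulr0 c); apply: cvgMr.
  by apply: cvg_expr; rewrite ger0_norm ?ltW.
move=> /cvgr0_norm_le /(_ e e0); apply: filterS => k.
by apply: le_trans; apply: le_trans (yc k) (ler_norm _).
Qed.

Lemma mx_decays_lt (R : realType) (m n : nat) (Y : nat -> 'M[R]_(m, n))
    (e : R) :
  mx_decays Y -> 0 < e -> \forall k \near \oo, `|Y k| <= e.
Proof.
move=> Yd e0.
have : \forall k \near \oo, forall ij : 'I_m * 'I_n, `|Y k ij.1 ij.2| <= e.
  by apply: filter_forall => ij; apply: decays_lt.
apply: filterS => k Yk; apply: mx_norm_le => [|i j]; first exact: ltW.
exact: (Yk (i, j)).
Qed.

(* The sum [V] of [|T^k x|] over [k <= N] is a Lyapunov function: along
   [x |-> T x] it drops by [|x| - |T^(N+1) x|], i.e. by at least [|x| / 2]. *)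
Lemma perturbed_linear_stability (R : realType) (d N : nat)
    (T Pi : 'M[R]_d) :
  (forall x : 'cV_d, Pi *m x = x ->
     `|iter N.+1 (mulmx T) x| <= 2^-1 * `|x|) ->
  exists2 eps : R, 0 < eps &
    forall eta : R, 0 < eta ->
    exists2 delta : R, 0 < delta &
    forall z : nat -> 'cV[R]_d,
      (forall k, Pi *m z k = z k) -> `|z 0%N| < delta ->
      (forall k, `|z k| < eta -> `|z k.+1 - T *m z k| <= eps * `|z k|) ->
      z @ \oo --> (0 : 'cV[R]_d).
Proof.
move=> contr.
pose V (x : 'cV[R]_d) : R := \sum_(k < N.+1) `|iter k (mulmx T) x|.
pose L : R := d%:R * `|T|.
have L0 : 0 <= L by rewrite mulr_ge0.
have iterL k (x : 'cV[R]_d) : `|iter k (mulmx T) x| <= L ^+ k * `|x|.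
  elim: k => [|k IHk]; first by rewrite expr0 mul1r.
  rewrite iterS; apply: le_trans (mx_norm_mul _ _) _.
  by rewrite exprS -[leRHS]mulrA ler_wpM2l.
pose C : R := \sum_(k < N.+1) L ^+ k.
have C1 : 1 <= C.
  rewrite /C big_ord_recl expr0 lerDl sumr_ge0 // => i _.
  by rewrite exprn_ge0.
have C0 : 0 < C by apply: lt_le_trans C1.
have VC x : V x <= C * `|x|.
  by rewrite /V /C mulr_suml; apply: ler_sum => k _.
have Vge x : `|x| <= V x.
  by rewrite /V big_ord_recl /= lerDl sumr_ge0.
have iterD k x y : iter k (mulmx T) (x + y) =
    iter k (mulmx T) x + iter k (mulmx T) y.
  by elim: k => //= k ->; rewrite mulmxDr.
have VD x y : V (x + y) <= V x + V y.
  rewrite /V -big_split; apply: ler_sum => k _.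
  by rewrite iterD ler_normD.
have VT x : Pi *m x = x -> V (T *m x) <= V x - 2^-1 * `|x|.
  move=> Pix; rewrite /V big_ord_recr big_ord_recl /=.
  rewrite (eq_bigr (fun i : 'I_N => `|iter (bump 0 i) (mulmx T) x|)); last first.
    by move=> i _; rewrite -iterSr.
  have := contr x Pix; rewrite iterSr.
  lra.
(* A perturbation of size [eps * |x|] raises [V] by at most [|x| / 4]. Half of the drop [|x| / 2]
   remains, and it is at least [eps * V x]. *)
pose eps : R := 4^-1 / C.
have eps0 : 0 < eps by rewrite divr_gt0 // invr_gt0.
have eps1 : eps < 1.
  rewrite /eps ltr_pdivrMr // mul1r; apply: lt_le_trans C1.
  by rewrite invf_lt1 // ltr1n.
(* This radius gives [V (z 0) < eta]; as [V] decreases and dominates the norm, the orbit never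
   leaves the region where the step bound holds. *)
exists eps => // eta eta0; exists (eta / C); first exact: divr_gt0.
move=> z Piz z0 zstep.
have V0 : V (z 0%N) < eta.
  by apply: le_lt_trans (VC _) _; rewrite mulrC -ltr_pdivlMr.
have Vnneg x : 0 <= V x by apply: le_trans (Vge x).
have step k : V (z k) < eta -> V (z k.+1) <= (1 - eps) * V (z k).
  move=> Vk.
  have zk : `|z k| < eta by apply: le_lt_trans (Vge _) Vk.
  have -> : z k.+1 = T *m z k + (z k.+1 - T *m z k) by rewrite addrC subrK.
  apply: le_trans (VD _ _) _.
  have h1 := VT _ (Piz k).
  have h2 : V (z k.+1 - T *m z k) <= 4^-1 * `|z k|.
    apply: le_trans (VC _) _.
    apply: le_trans (ler_wpM2l (ltW C0) (zstep k zk)) _.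
    by rewrite mulrA /eps mulrCA divff ?mulr1 // gt_eqF.
  have h3 : eps * V (z k) <= 4^-1 * `|z k|.
    rewrite /eps -mulrA ler_wpM2l ?invr_ge0 // ler_pdivrMl //.
  lra.
have q0 : 0 <= 1 - eps by rewrite subr_ge0 ltW.
have Vq k : V (z k) <= (1 - eps) ^+ k * V (z 0%N).
  elim: k => [|k IHk]; first by rewrite expr0 mul1r.
  have Vk : V (z k) < eta.
    apply: le_lt_trans IHk _; apply: le_lt_trans V0.
    by rewrite ler_piMl // exprn_ile1 // gerBl ltW.
  by apply: le_trans (step k Vk) _; rewrite exprS -mulrA ler_wpM2l.
apply/norm_cvg0P.
apply: (@squeeze_cvgr _ _ _ _ (fun=> 0) (fun k => (1 - eps) ^+ k * V (z 0%N))).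
- by apply: nearW => k; rewrite normr_ge0 /=; apply: le_trans (Vge _) (Vq k).
- exact: cvg_cst.
- rewrite -[0 : R](mul0r (V (z 0%N))); apply: cvgMl.
  by apply: cvg_expr; rewrite ger0_norm // gtrBl.
Qed.

(** * Calculus of separable functions *)

Lemma derive_eq_derive1 (R : realType) (n : nat) (F : 'cV[R]_n -> R)
    (g : R -> R) (x v : 'cV[R]_n) (t : R) :
  (forall h, F (h *: v + x) - F x = g (h + t) - g t) ->
  'D_v F x = g^`() t.
Proof.
move=> Fg; rewrite derive1E /derive.
rewrite (_ : (fun h => _) = (fun h => h^-1 *: ((g \o shift t) (h *: 1) - g t))) //.
by apply/funext => h /=; rewrite /shift /= Fg [h *: 1]mulr1.
Qed.

Lemma gradient_separable (R : realType) (n : nat) (f : 'I_n -> R -> R)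
    (x : 'cV[R]_n) :
  gradient (separable f) x = \col_v (f v)^`() (x v 0).
Proof.
apply/colP => i; rewrite !mxE; apply: (@derive_eq_derive1 _ _ _ (f i)) => h.
rewrite /separable (bigD1 i) //= [X in _ - X](bigD1 i) //=.
rewrite !mxE !eqxx mulr1 opprD addrACA.
rewrite -[RHS]addr0; congr (_ + _); apply/eqP.
rewrite subr_eq0; apply/eqP; apply: eq_bigr => j ji.
by rewrite !mxE (negPf ji) mulr0 add0r.
Qed.

Lemma hessian_separable (R : realType) (n : nat) (f : 'I_n -> R -> R)
    (x : 'cV[R]_n) :
  hessian (separable f) x = diag_mx (\row_v (f v)^`()^`() (x v 0)).
Proof.
apply/matrixP => i j; rewrite !mxE.
have [<-|ij] := eqVneq i j.
  rewrite mulr1n; apply: (@derive_eq_derive1 _ _ _ (f i)^`()) => h.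
  by rewrite !gradient_separable !mxE !eqxx mulr1.
rewrite mulr0n -[RHS](derive1_cst (0 : R) (0 : R)).
apply: (@derive_eq_derive1 _ _ _ (cst 0)) => h.
by rewrite !gradient_separable !mxE (negPf ij) mulr0 add0r !subrr.
Qed.

Lemma is_derive_affine (R : realType) (a c t : R) :
  is_derive t (1 : R) (fun u : R => a + u * c) c.
Proof.
have -> : (fun u : R => a + u * c) = cst a + c *: id.
  by apply/funext => u /=; rewrite [u * _]mulrC.
apply: (is_derive_eq (is_deriveD (is_derive_cst a t 1)
  (is_deriveZ c (is_derive_id t 1)))).
by rewrite add0r [_ *: _]mulr1.
Qed.

(** The line [x + t *: s] stays feasible, so [F] restricted to it has a minimum at [t = 0], where
    its derivative is the pairing of the gradient with [s]. *)
Lemma optimizer_stationary (R : realType) (m n : nat) (A : 'M[R]_(m, n))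
    (b : 'cV[R]_m) (f : 'I_n -> R -> R) (x s : 'cV[R]_n) :
  (forall v t, derivable (f v) t 1) ->
  optimizer A b (separable f) x -> A *m s = 0 ->
  (gradient (separable f) x)^T *m s = 0.
Proof.
move=> fd [Ax xmin] As.
pose phi (t : R) := separable f (x + t *: s).
have phid (t : R) :
    is_derive t (1 : R) phi (\sum_v derive1 (f v) (x v 0 + t * s v 0) * s v 0).
  have phiE : phi = \sum_(v < n) (fun t => f v (x v 0 + t * s v 0)).
    rewrite fct_sumE; apply/funext => u; rewrite /phi /separable.
    by apply: eq_bigr => v _; rewrite !mxE.
  rewrite phiE; apply: is_derive_sum => v.
  have aff := is_derive_affine (x v 0) (s v 0) t.
  have fv : is_derive (x v 0 + t * s v 0) (1 : R) (f v)
      (derive1 (f v) (x v 0 + t * s v 0)).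
    by rewrite derive1E; apply: derivableP.
  exact: (@is_derive1_comp _ (f v) (fun t => x v 0 + t * s v 0) t _ _ fv aff).
have phi0 : is_derive (0 : R) (1 : R) phi 0.
  apply: (@derive1_at_min _ phi (-1) 1); rewrite ?in_itv /= ?oppr_lt0 ?ltr01 //.
  move=> t _; rewrite /phi scale0r addr0; apply: xmin.
  by rewrite /feasible mulmxDr -scalemxAr As scaler0 addr0.
have := @derive_val _ _ _ _ _ _ _ phi0.
rewrite (@derive_val _ _ _ _ _ _ _ (phid 0)) => sum0.
apply/matrixP => i j; rewrite !ord1 !mxE -[RHS]sum0.
apply: eq_bigr => v _.
by rewrite gradient_separable !mxE mul0r addr0.
Qed.

(** Stating the radius [d] through the filter [0^'+] lets finitely many such radii be merged into
    one. *)
Lemma derivable_remainder (R : realType) (g : R -> R) (x e : R) :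
  derivable g x 1 -> 0 < e ->
  \forall d \near 0^'+, forall t, `|t| < d ->
    `|g (x + t) - g x - derive1 g x * t| <= e * `|t|.
Proof.
move=> gd e0.
have : \forall h \near 0^',
    `|derive1 g x - h^-1 *: ((g \o shift x) (h *: 1) - g x)| <= e.
  by rewrite derive1E; exact: (@cvgr_dist_le _ _ _ _ _ _ _ gd e e0).
rewrite /dnbhs /within /= => /nbhs_ballP [d /= d0 hd].
near=> c => t tc.
have [->|t0] := eqVneq t 0; first by rewrite addr0 mulr0 !subrr normr0 mulr0.
have {}hd : `|derive1 g x - t^-1 *: ((g \o shift x) (t *: 1) - g x)| <= e.
  apply: hd => //=; rewrite /ball /= sub0r normrN.
  by apply: lt_trans tc _; near: c; exact: nbhs_right_lt.
rewrite -ler_pdivrMr ?normr_gt0 // -normfV -normrM -normrN.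
rewrite [X in `|X|](_ : _ = derive1 g x - t^-1 *: ((g \o shift x) (t *: 1) - g x)) //.
by rewrite /= /shift /GRing.scale /= mulr1 [t + x]addrC; field.
Unshelve. all: by end_near. Qed.

Lemma gradient_remainder (R : realType) (n : nat) (f : 'I_n -> R -> R)
    (x : 'cV[R]_n) (eps : R) :
  (forall v t, derivable (f v)^`() t 1) -> 0 < eps ->
  exists2 eta : R, 0 < eta & forall e, `|e| < eta ->
    `|gradient (separable f) (x + e) - gradient (separable f) x
      - hessian (separable f) x *m e| <= eps * `|e|.
Proof.
move=> fd eps0.
have : \forall d \near 0^'+, 0 < d /\ forall v t, `|t| < d ->
    `|derive1 (f v) (x v 0 + t) - derive1 (f v) (x v 0)
      - derive1 (derive1 (f v)) (x v 0) * t| <= eps * `|t|.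
  apply: filterI; first exact: nbhs_right_gt.
  apply: (@filter_forall _ _ _ (0^'+)) => v.
  exact: (derivable_remainder (fd v (x v 0)) eps0).
move=> /filter_ex [d [d0 hd]]; exists d => // e ed.
apply: mx_norm_le => [|i j]; first by rewrite mulr_ge0 // ltW.
rewrite ord1 hessian_separable !gradient_separable mul_diag_mx !mxE.
have ei := mx_entry_le_norm e i 0.
apply: le_trans (hd _ _ (le_lt_trans ei ed)) _.
by rewrite ler_wpM2l // ltW.
Qed.

(** * The multi-step iteration as a first-order system *)

(** The block companion matrix of the linearized recurrence, acting on the newer error stacked above
    the older one. *)
Definition multi_step_mx (R : pzRingType) (n : nat) (B : 'M[R]_n) (al be : R) :
    'M[R]_(n + n) :=
  block_mx ((1 + be)%:M - al *: B) (- be)%:M 1%:M 0.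

Lemma multi_step_mx_col (R : comPzRingType) (n p : nat) (B : 'M[R]_n)
    (al be : R) (u v : 'M[R]_(n, p)) :
  multi_step_mx B al be *m col_mx u v =
  col_mx ((1 + be) *: u - al *: (B *m u) - be *: v) u.
Proof.
rewrite mul_block_col mul0mx addr0 mul1mx mulmxBl !mul_scalar_mx.
by rewrite -scalemxAl scaleNr.
Qed.

(** Iterating [T] on the matrix [Pi] instead of on vectors gives one [N] for all [x]: the lower
    block of [T^k Pi] solves the matrix recurrence inside the range of [P], hence decays. *)
Lemma multi_step_mx_contraction (R : realType) (n : nat)
    (B L P : 'M[R]_n.+1) (al be : R) :
  0 < al -> 0 <= be -> be < 1 -> real_spectrum B ->
  (forall la, eigenvalue B la -> la != 0 -> 0 < la /\ al * la < 2 * (1 + be)) ->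
  P *m P = P -> P *m B = B -> L *m (B *m P) = P ->
  exists N, forall x : 'cV_(n.+1 + n.+1), block_mx P 0 0 P *m x = x ->
    `|iter N.+1 (mulmx (multi_step_mx B al be)) x| <= 2^-1 * `|x|.
Proof.
move=> al0 be0 be1 Breal Beig PP PB LBP.
set T := multi_step_mx B al be; set Pi := block_mx P 0 0 P.
pose Z k := iter k (mulmx T) Pi; pose Y k := dsubmx (Z k).
have ZS k : Z k.+1 = col_mx ((1 + be) *: usubmx (Z k)
    - al *: (B *m usubmx (Z k)) - be *: Y k) (usubmx (Z k)).
  by rewrite /Z iterS -/(Z k) -[in LHS](vsubmxK (Z k)) multi_step_mx_col.
have YS k : Y k.+1 = usubmx (Z k) by rewrite /Y ZS col_mxKd.
have ZE k : Z k = col_mx (Y k.+1) (Y k) by rewrite YS vsubmxK.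
have rec k :
    Y k.+2 = (1 + be) *: Y k.+1 - al *: (B *m Y k.+1) - be *: Y k.
  by rewrite YS ZS col_mxKu -YS.
have PY2 k : P *m Y k = Y k /\ P *m Y k.+1 = Y k.+1.
  elim: k => [|k [Yk Yk1]].
    rewrite YS /Y /Z /= /Pi block_mxEv col_mxKd col_mxKu.
    by rewrite !mul_mx_row PP mulmx0.
  split=> //; rewrite rec !mulmxBr -!scalemxAr Yk Yk1 mulmxA PB //.
have Yd : mx_decays Y.
  apply: (mx_decays_of_real_spectrum al0 be0 be1 Breal Beig PB LBP _ rec).
  by move=> k; case: (PY2 k).
pose d : R := (n.+1 + n.+1)%:R.
have d0 : 0 < d by rewrite ltr0n.
(* Dividing by [d] offsets the dimension factor in [mx_norm_mul]. *)
have e0 : 0 < 2^-1 / d by rewrite divr_gt0 // invr_gt0.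
have [N _ YN] := mx_decays_lt Yd e0.
exists N => x Pix.
have iterE k : iter k (mulmx T) x = Z k *m x.
  by elim: k => [|k IHk]; rewrite /Z //= IHk mulmxA.
rewrite iterE; apply: le_trans (mx_norm_mul _ _) _.
apply: ler_wpM2r => //; rewrite -/d mulrC -ler_pdivlMr // ZE.
apply: mx_norm_col_mx_le; first exact: ltW.
- by apply: YN => /=; rewrite -addn2 leq_addr.
- by apply: YN => /=; rewrite -addn1 leq_addr.
Qed.

Lemma feasible_multi_step (R : realType) (m n : nat) (A : 'M[R]_(m, n))
    (b : 'cV[R]_m) (W : 'M[R]_n) (F : 'cV[R]_n -> R) (al be : R)
    (x : nat -> 'cV[R]_n) :
  A *m W = 0 -> feasible A b (x 0%N) -> feasible A b (x 1%N) ->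
  multi_step_iteration F W al be x -> forall k, feasible A b (x k).
Proof.
move=> AW x0 x1 xrec k.
suff [] : feasible A b (x k) /\ feasible A b (x k.+1) by [].
elim: k => [//|k [xk xk1]]; split=> //.
rewrite /feasible xrec mulmxDr mulmxBr -!scalemxAr mulmxA AW mul0mx scaler0.
by rewrite subr0 mulmxBr xk xk1 subrr scaler0 addr0.
Qed.

(** The stacked errors follow [multi_step_mx] up to a term in the upper block only, which is [al]
    times [W] applied to the Taylor remainder of the gradient. *)
Lemma multi_step_local_convergence (R : realType) (m n N : nat)
    (A : 'M[R]_(m, n)) (b : 'cV[R]_m) (f : 'I_n -> R -> R) (W : 'M[R]_n)
    (xs : 'cV[R]_n) (al be : R) :
  (forall v t, derivable (f v)^`() t 1) -> 0 <= al ->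
  A *m W = 0 -> feasible A b xs -> W *m gradient (separable f) xs = 0 ->
  (forall x : 'cV_(n + n),
    block_mx (kernel_projector A) 0 0 (kernel_projector A) *m x = x ->
    `|iter N.+1 (mulmx (multi_step_mx (W *m hessian (separable f) xs) al be)) x|
      <= 2^-1 * `|x|) ->
  exists2 delta : R, 0 < delta &
    forall x : nat -> 'cV[R]_n,
      feasible A b (x 0%N) -> feasible A b (x 1%N) ->
      `|x 0%N - xs| < delta -> `|x 1%N - xs| < delta ->
      multi_step_iteration (separable f) W al be x ->
      x @ \oo --> xs.
Proof.
move=> fd al0 AW xsA Wg contr.
set F := separable f; set H := hessian F xs.
have [eps eps0 stab] := perturbed_linear_stability contr.
(* Bounds the amplification of the gradient remainder by [al *: W]; the summand [1] keeps [c]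
   positive, so that [eps / c] is a valid tolerance. *)
pose c : R := 1 + al * (n%:R * `|W|).
have c0 : 0 < c by rewrite ltr_pwDl // !mulr_ge0.
have [eta eta0 rem] := gradient_remainder xs fd (divr_gt0 eps0 c0).
have [delta delta0 conv] := stab eta eta0.
exists delta => // x x0 x1 d0 d1 xrec.
have xA := feasible_multi_step AW x0 x1 xrec.
pose e k := x k - xs.
have Ae k : A *m e k = 0 by rewrite mulmxBr xA xsA subrr.
pose z k := col_mx (e k.+1) (e k).
have ez k : `|e k| <= `|z k| by apply: mx_norm_dsubmx_le.
have eSz k : `|e k.+1| <= `|z k| by apply: mx_norm_usubmx_le.
have z0 : z @ \oo --> (0 : 'cV[R]_(n + n)).
  apply: conv => [k||k zk].
  - by rewrite mul_block_col !mul0mx addr0 add0r !kernel_projector_id.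
  - apply: (@le_lt_trans _ _ (Num.max `|e 1%N| `|e 0%N|)).
      by apply: mx_norm_col_mx_le; rewrite ?le_max ?lexx ?orbT ?normr_ge0.
    by rewrite gt_max d0 d1.
  - pose r := gradient F (x k.+1) - gradient F xs - H *m e k.+1.
    have -> : z k.+1 - multi_step_mx (W *m H) al be *m z k =
        col_mx (- (al *: (W *m r))) 0.
      rewrite multi_step_mx_col opp_col_mx add_col_mx subrr; congr col_mx.
      have -> : W *m r = W *m gradient F (x k.+1) - W *m H *m e k.+1.
        by rewrite [LHS]mulmxBr [W *m (_ - _)]mulmxBr Wg subr0 mulmxA.
      rewrite -/H; move: (W *m H *m e k.+1) => whe; rewrite /e xrec.
      by apply/colP => i; rewrite !mxE; ring.
    have rle : `|r| <= eps / c * `|e k.+1|.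
      have := rem (e k.+1) (le_lt_trans (eSz k) zk).
      by rewrite [xs + _]addrC subrK.
    apply: mx_norm_col_mx_le; rewrite ?normr0 ?mulr_ge0 ?(ltW eps0) //.
    rewrite normrN normrZ ger0_norm //.
    apply: (@le_trans _ _ (c * (eps / c * `|z k|))); last first.
      by rewrite mulrA mulrCA divff ?mulr1 ?gt_eqF.
    apply: (@le_trans _ _ (c * `|r|)); last first.
      apply: ler_wpM2l; first exact: ltW.
      by apply: le_trans rle _; rewrite ler_wpM2l // divr_ge0 ?ltW.
    apply: (@le_trans _ _ (al * (n%:R * `|W|) * `|r|)).
      by rewrite -[leRHS]mulrA; apply: ler_wpM2l => //; exact: mx_norm_mul.
    by rewrite ler_wpM2r // lerDr.
apply/subr_cvg0/norm_cvg0P.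
apply: (@squeeze_cvgr _ _ _ _ (fun=> 0) (fun k => `|z k|)).
- by apply: nearW => k; rewrite normr_ge0 /= ez.
- exact: cvg_cst.
- exact/norm_cvg0P.
Qed.

(** Serves to place [x 1] near the optimizer when the gradient iteration, given only [x 0], is
    treated as a two-step one. *)
Lemma gradient_step_bound (R : realType) (n : nat) (f : 'I_n -> R -> R)
    (W : 'M[R]_n) (xs : 'cV[R]_n) (al : R) :
  (forall v t, derivable (f v)^`() t 1) ->
  W *m gradient (separable f) xs = 0 ->
  exists eta K : R, [/\ 0 < eta, 0 < K & forall x, `|x - xs| < eta ->
    `|x - al *: (W *m gradient (separable f) x) - xs| <= K * `|x - xs|].
Proof.
move=> fd Wg; set F := separable f; set H := hessian F xs.
have [eta eta0 rem] := gradient_remainder xs fd ltr01.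
pose K : R := 1 + `|al| * (n%:R * `|W| * (1 + n%:R * `|H|)).
exists eta, K; split=> // [|x xeta].
  by rewrite ltr_pwDl // !mulr_ge0 // addr_ge0 // mulr_ge0.
set e := x - xs.
have xE : x = xs + e by rewrite addrC subrK.
pose r := gradient F x - gradient F xs - H *m e.
have rle : `|r| <= `|e| by have := rem e xeta; rewrite mul1r /r xE.
have -> : x - al *: (W *m gradient F x) - xs = e - al *: (W *m (r + H *m e)).
  by rewrite subrK mulmxBr Wg subr0 addrAC.
apply: le_trans (ler_normB _ _) _.
rewrite /K mulrDl mul1r lerD2l normrZ -[leRHS]mulrA ler_wpM2l //.
apply: le_trans (mx_norm_mul _ _) _; rewrite -[leRHS]mulrA.
apply: ler_wpM2l; first by rewrite mulr_ge0.
apply: le_trans (ler_normD _ _) _; rewrite mulrDl mul1r lerD //.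
exact: mx_norm_mul.
Qed.

(** * Stability for the step sizes built from the estimates *)

Theorem proposition4 (R : realType) (m n : nat) (E : {set 'I_n * 'I_n})
    (f : 'I_n -> R -> R) (l u : 'I_n -> R)
    (A : 'M[R]_(m, n)) (b : 'cV[R]_m) (W : 'M[R]_n) (xstar : 'cV[R]_n)
    (lmin lmax lm lp : R)
    (f_convex : forall v, convex_function [set: R^o] (f v))
    (f_C2 : forall v, twice_continuously_differentiable (f v))
    (l_gt0 : forall v, 0 < l v)
    (l_le_u : forall v, l v <= u v)
    (f_bounds : forall v t, l v <= (f v)^`()^`() t <= u v)
    (b_range : exists y : 'cV[R]_n, A *m y = b)
    (A_full_rank : \rank A = m)
    (xstar_opt : unique_optimizer A b (separable f) xstar)
    (W_graph : supported_on_graph E W)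
    (AW0 : A *m W = 0)
    (WAT0 : W *m A^T = 0)
    (m_lt_n : (m < n)%N)
    (W_zero_eigs : mup 0 (char_poly W) = m)
    (WH_real : real_spectrum (W *m hessian (separable f) xstar))
    (lminP : smallest_nonzero_eigenvalue
               (W *m hessian (separable f) xstar) lmin)
    (lmaxP : largest_eigenvalue (W *m hessian (separable f) xstar) lmax)
    (lmin_gt0 : 0 < lmin)
    (lm_gt0 : 0 < lm)
    (lm_lt_lp : lm < lp)
    (lmax_lt : lmax < lp + lm) :
  (exists2 delta : R, 0 < delta &
     forall x : nat -> 'cV[R]_n,
       feasible A b (x 0%N) ->
       `|x 0%N - xstar| < delta ->
       weighted_gradient_iteration (separable f) W (2 / (lp + lm)) x ->
       x @ \oo --> xstar)
  /\
  (exists2 delta : R, 0 < delta &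
     forall x : nat -> 'cV[R]_n,
       feasible A b (x 0%N) ->
       feasible A b (x 1%N) ->
       `|x 0%N - xstar| < delta ->
       `|x 1%N - xstar| < delta ->
       multi_step_iteration (separable f) W
         ((2 / (Num.sqrt lp + Num.sqrt lm)) ^+ 2)
         (((Num.sqrt lp - Num.sqrt lm) / (Num.sqrt lp + Num.sqrt lm)) ^+ 2) x ->
       x @ \oo --> xstar).
Proof.
(* Evaluating polynomials at a square matrix requires size [n.+1]; size [0] contradicts [m < n]. *)
case: n E f l u A W xstar f_convex f_C2 l_gt0 l_le_u f_bounds b_range A_full_rank
  xstar_opt W_graph AW0 WAT0 m_lt_n W_zero_eigs WH_real lminP lmaxP
  => [//|n] E f l u A W xstar _ f_C2 l_gt0 _ f_bounds _ A_full_rank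
  xstar_opt _ AW0 WAT0 m_lt_n W_zero_eigs WH_real lminP lmaxP.
have f'd v t : derivable (f v)^`() t 1 by case: (f_C2 v).
have fd v t : derivable (f v) t 1 by case: (f_C2 v).
have [[xA xmin] _] := xstar_opt.
have Wg : W *m gradient (separable f) xstar = 0.
  have [|nu ->] := @row_space_of_orthogonal _ _ _ A (gradient (separable f) xstar).
    by move=> s; apply: optimizer_stationary fd (conj xA xmin).
  by rewrite mulmxA WAT0 mul0mx.
set B := W *m hessian (separable f) xstar in WH_real lminP lmaxP.
pose P := kernel_projector A.
have AP : A *m P = 0 by exact: kernel_projector_ker.
have PP : P *m P = P by exact: kernel_projector_id.
have PB : P *m B = B by rewrite kernel_projector_id // /B mulmxA AW0 mul0mx.
have [L LBP] : exists L, L *m (B *m P) = P.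
  apply: left_inverse_on_range => v.
  rewrite /B hessian_separable.
  apply: (weighted_hessian_injective A_full_rank WAT0).
  - by rewrite W_zero_eigs.
  - move=> i; rewrite mxE; case/andP: (f_bounds i (xstar i 0)) => + _.
    exact: lt_le_trans.
  - by rewrite mulmxA AP mul0mx.
(* Both parameter choices satisfy this identity, which turns [lmax < lp + lm] into
   [al * lmax < 2 * (1 + be)]. *)
have core al be : 0 < al -> 0 <= be -> be < 1 ->
    2 * (1 + be) = al * (lp + lm) ->
    exists2 delta : R, 0 < delta &
    forall x : nat -> 'cV[R]_n.+1,
      feasible A b (x 0%N) -> feasible A b (x 1%N) ->
      `|x 0%N - xstar| < delta -> `|x 1%N - xstar| < delta ->
      multi_step_iteration (separable f) W al be x ->
      x @ \oo --> xstar.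
  move=> al0 be0 be1 albe.
  have Beig la : eigenvalue B la -> la != 0 ->
      0 < la /\ al * la < 2 * (1 + be).
    case: lminP lmaxP => [_ _ lminle] [_ lmaxge] Bla la0; split.
      exact: lt_le_trans (lminle _ Bla la0).
    by rewrite albe ltr_pM2l // (le_lt_trans (lmaxge _ Bla)).
  have [N contr] := multi_step_mx_contraction al0 be0 be1 WH_real Beig PP PB LBP.
  exact: multi_step_local_convergence f'd (ltW al0) AW0 xA Wg contr.
have lp0 : 0 < lp by apply: lt_trans lm_lt_lp.
have s0 : 0 < lp + lm by rewrite addr_gt0.
split.
- have [||||delta delta0 conv] := core (2 / (lp + lm)) 0.
  + by rewrite divr_gt0.
  + exact: lexx.
  + exact: ltr01.
  + by rewrite divfK ?gt_eqF // addr0 mulr1.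
  (* The gradient iteration is the multi-step one with [beta = 0]. *)
  have [eta [K [eta0 K0 bnd]]] :=
    gradient_step_bound (2 / (lp + lm)) f'd Wg.
  (* [eta] validates the step bound, [delta] controls [x 0], and [delta / K] controls [x 1]. *)
  exists (Num.min eta (Num.min delta (delta / K))).
    by rewrite !lt_min eta0 delta0 divr_gt0.
  move=> x x0; rewrite !lt_min => /and3P[deta d0 dK] xrec.
  apply: conv => //.
  + by rewrite /feasible xrec mulmxBr -scalemxAr mulmxA AW0 mul0mx scaler0 subr0.
  + rewrite xrec; apply: le_lt_trans (bnd _ deta) _.
    by rewrite mulrC -ltr_pdivlMr.
  + by move=> k; rewrite xrec scale0r addr0.
- set sp := Num.sqrt lp; set sm := Num.sqrt lm.
  have sm0 : 0 < sm by rewrite sqrtr_gt0.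
  have sp0 : 0 < sp by rewrite sqrtr_gt0.
  have smp : sm < sp by rewrite ltr_sqrt.
  have spD : 0 < sp + sm by rewrite addr_gt0.
  apply: core.
  + by rewrite exprn_gt0 // divr_gt0.
  + exact: sqr_ge0.
  + rewrite expr_lt1 // ?divr_ge0 ?subr_ge0 ?ltW //.
    by rewrite ltr_pdivrMr // mul1r; lra.
  (* Amounts to [(sp + sm)^2 + (sp - sm)^2 = 2 * (sp^2 + sm^2)]. *)
  + rewrite -(sqr_sqrtr (ltW lp0)) -(sqr_sqrtr (ltW lm_gt0)) -/sp -/sm.
    by field; rewrite gt_eqF.
Qed.
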